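(* Under the Qualification assumption, let $(m,\pi,u,\gamma,P)$ and $(m',\pi',u',\gamma',P')$ be two solutions in $\mathcal R\times\mathcal K$ to the mean field game system (MFG). Assume that $F$ and $\phi$ are differentiable with respect to their second variable (i.e. $F(s,\cdot)$ is differentiable on $\mathbb R(S)$ for all $s\in\bar{\mathcal T}$ and $\phi(t,\cdot)$ is differentiable on $\mathbb R$ for all $t\in\mathcal T$). Then $(u,\gamma,P)=(u',\gamma',P')$. If moreover, for any $(t,x)\in\mathcal T\times S$, $\ell(t,x,\cdot)$ is strictly convex (on its domain), then $(m,\pi)=(m',\pi')$ and thus (MFG) has a unique solution.
   Context: Let $T\ge 1$, $n\ge 1$ be integers, $\mathcal T=\{0,\dots,T-1\}$, $\bar{\mathcal T}=\{0,\dots,T\}$, $S=\{0,\dots,n-1\}$. For a finite set $A$, $\mathbb R(A)$ is the space of functions $A\to\mathbb R$ (Euclidean inner product and norm). $\Delta(S)=\{\rho:S\to[0,1]:\sum_{x}\rho(x)=1\}$. Spaces: $\mathcal R=\mathbb R(\bar{\mathcal T}\times S)\times\mathbb R(\mathcal T\times S^2)$, $\mathcal K=\mathbb R(\bar{\mathcal T}\times S)\times\mathbb R(\bar{\mathcal T}\times S)\times\mathbb R(\mathcal T)$. Data: $m_0\in\Delta(S)$, $\alpha:\mathcal T\times S^2\to\mathbb R$, $\ell:\mathcal T\times S\times\mathbb R(S)\to\mathbb R\cup\{+\infty\}$, $\phi:\mathcal T\times\mathbb R\to\mathbb R\cup\{+\infty\}$, $F:\bar{\mathcal T}\times\mathbb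 R(S)\to\mathbb R\cup\{+\infty\}$. Standing assumption: for all $(t,s,x)\in\mathcal T\times\bar{\mathcal T}\times S$ the functions $\ell(t,x,\cdot)$, $F(s,\cdot)$, $\phi(t,\cdot)$ are proper, convex and lower semicontinuous, and $\mathrm{dom}(\ell(t,x,\cdot))\subseteq\Delta(S)$. Subdifferentials are convex subdifferentials in the last variable. System (MFG), for $(m,\pi,u,\gamma,P)\in\mathcal R\times\mathcal K$ and all $(t,s,x)\in\mathcal T\times\bar{\mathcal T}\times S$: (i) $u(t,x)=\inf_{\rho\in\Delta(S)}\big[\ell(t,x,\rho)+\gamma(t,x)+\sum_{y\in S}\rho(y)(\alpha(t,x,y)P(t)+u(t+1,y))\big]$, $u(T,x)=\gamma(T,x)$; (ii) $\pi(t,x,\cdot)\in\Delta(S)$ attains the infimum in (i); (iii) $m(t+1,x)=\sum_{y\in S}m(t,y)\pi(t,y,x)$, $m(0,x)=m_0(x)$; (iv) $\gamma(s,\cdot)\in\partial F(s,m(s,\cdot))$; (v) $P(t)\in\partial\phi\big(t,\sum_{(x,y)\in S^2}m(t,x)\pi(t,x,y)\alpha(t,x,y)\big)$. Qualification assumption: there exists $\alpha_0>0$ such that for every $\varepsilon=(\varepsilon_1,\varepsilon_2,\varepsilon_3)\in\mathcal K$ with $\|\varepsilon\|\le\alpha_0$ there exists $\pi:\mathcal T\times S\times S\to\mathbb R$ with $\pi(t,x,\cdot)\in\mathrm{dom}(\ell(t,x,\cdot))$ for all $(t,x)$ such that $m_1[\varepsilon,\pi]\ge0$, $m_2[\varepsilon,\pi](s,\cdot)\in\mathrm{dom}(F(s,\cdot))$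 for all $s\in\bar{\mathcal T}$, and $D[\varepsilon,\pi](t)\in\mathrm{dom}(\phi(t,\cdot))$ for all $t\in\mathcal T$. Here $m_1=m_1[\varepsilon,\pi]$ solves $m_1(0,x)-\varepsilon_1(0,x)=m_0(x)$, $m_1(t+1,x)=\sum_{y\in S}m_1(t,y)\pi(t,y,x)-\varepsilon_1(t+1,x)$; $m_2[\varepsilon,\pi]=m_1[\varepsilon,\pi]+\varepsilon_2$; $D[\varepsilon,\pi](t)=\sum_{(x,y)\in S^2}m_1[\varepsilon,\pi](t,x)\pi(t,x,y)\alpha(t,x,y)+\varepsilon_3(t)$. *)

(* Defs.v *)
From mathcomp Require Import all_boot all_order all_algebra.
From mathcomp Require Import all_classical all_reals all_analysis.
Set Implicit Arguments.
Unset Strict Implicit.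
Unset Printing Implicit Defensive.
Import Order.TTheory GRing.Theory Num.Theory.
Import numFieldNormedType.Exports.
Local Open Scope classical_set_scope.
Local Open Scope ring_scope.

(* R(S) is 'rV[R]_n, so that rho(y) is [rho 0 y];
   R(Tbar x S) is 'M[R]_(T.+1, n), so that m(s, .) is [row s m]; R(T x S^2) is
   {ffun 'I_T -> 'M[R]_n}, so that pi(t, x, .) is [row x (pi t)]. *)

Section ConvexAnalysis.
Context {R : realType}.

Definition edom {V : Type} (f : V -> \bar R) : set V :=
  [set x | (f x < +oo)%E].

(* In particular a proper function takes its values in R \cup {+oo}. *)
Definition proper {V : Type} (f : V -> \bar R) : Prop :=
  (forall x, (-oo < f x)%E) /\ edom f !=set0.

Definition econvex {V : lmodType R} (f : V -> \bar R) : Prop :=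
  forall (x y : V) (l : R), 0 < l < 1 ->
    (f (l *: x + (1 - l) *: y)%R <= l%:E * f x + (1 - l)%R%:E * f y)%E.

Definition strictly_convex_on_dom {V : lmodType R} (f : V -> \bar R) : Prop :=
  forall (x y : V) (l : R), x \in edom f -> y \in edom f -> x != y ->
    0 < l < 1 ->
    (f (l *: x + (1 - l) *: y)%R < l%:E * f x + (1 - l)%R%:E * f y)%E.

Definition dot {n : nat} (u v : 'rV[R]_n) : R := \sum_(i < n) u 0 i * v 0 i.

Definition subdifferential {V : zmodType} (ip : V -> V -> R)
    (f : V -> \bar R) (x : V) : set V :=
  [set g | f x \is a fin_num /\
           forall y, (f x + (ip g (y - x)%R)%:E <= f y)%E].

(* An extended real-valued function is differentiable everywhere when it is
   finite everywhere and its real-valued version is (Frechet) differentiable. *)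
Definition edifferentiable {V : normedModType R} (f : V -> \bar R) : Prop :=
  (forall x, f x \is a fin_num) /\
  (forall x, differentiable (fun y : V => fine (f y) : R^o) x).

Definition simplex (n : nat) : set 'rV[R]_n :=
  [set rho | (forall x, 0 <= rho 0 x <= 1) /\ \sum_(x < n) rho 0 x = 1].

End ConvexAnalysis.

Arguments simplex {R} n.

(* For t in {0, ..., T-1}, the times t and t+1 as elements of {0, ..., T}. *)
Definition now {T : nat} (t : 'I_T) : 'I_T.+1 := widen_ord (leqnSn T) t.
Definition next {T : nat} (t : 'I_T) : 'I_T.+1 := lift ord0 t.

Record mfg_data (R : realType) (T n : nat) := MFGData {
  m0 : 'rV[R]_n;
  alpha : 'I_T -> 'M[R]_n;
  ell : 'I_T -> 'I_n -> 'rV[R]_n -> \bar R;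
  phi : 'I_T -> R -> \bar R;
  F : 'I_T.+1 -> 'rV[R]_n -> \bar R }.

Record mfg_vars (R : realType) (T n : nat) := MFGVars {
  vm : 'M[R]_(T.+1, n);
  vpi : {ffun 'I_T -> 'M[R]_n};
  vu : 'M[R]_(T.+1, n);
  vgamma : 'M[R]_(T.+1, n);
  vP : 'rV[R]_T }.

Section MFG.
Context {R : realType} {T n : nat} (d : mfg_data R T n).

Definition standing_assumption : Prop :=
  [/\ m0 d \in simplex n,
      (forall t x, [/\ proper (ell d t x), econvex (ell d t x),
         lower_semicontinuous (ell d t x) & edom (ell d t x) `<=` simplex n]),
      (forall s, [/\ proper (F d s), econvex (F d s) &
         lower_semicontinuous (F d s)]) &
      (forall t, [/\ proper (phi d t), econvex (phi d t : R^o -> \bar R) &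
         lower_semicontinuous (phi d t)])].

Definition demand (m : 'M[R]_(T.+1, n)) (pi : {ffun 'I_T -> 'M[R]_n})
    (t : 'I_T) : R :=
  \sum_(x < n) \sum_(y < n) m (now t) x * pi t x y * alpha d t x y.

(* The function of rho minimized in the dynamic programming equation. *)
Definition bellman_cost (u gamma : 'M[R]_(T.+1, n)) (P : 'rV[R]_T)
    (t : 'I_T) (x : 'I_n) (rho : 'rV[R]_n) : \bar R :=
  (ell d t x rho +
   (gamma (now t) x +
    \sum_(y < n) rho 0 y * (alpha d t x y * P 0 t + u (next t) y))%R%:E)%E.

Definition bellman_value (u gamma : 'M[R]_(T.+1, n)) (P : 'rV[R]_T)
    (t : 'I_T) (x : 'I_n) : \bar R :=
  ereal_inf [set bellman_cost u gamma P t x rho | rho in simplex n].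

Definition MFG (z : mfg_vars R T n) : Prop :=
  let: MFGVars m pi u gamma P := z in
  [/\ (forall t x, (u (now t) x)%:E = bellman_value u gamma P t x) /\
        (forall x, u ord_max x = gamma ord_max x),
      (forall t x, row x (pi t) \in simplex n /\
         bellman_cost u gamma P t x (row x (pi t))
           = bellman_value u gamma P t x),
      (forall t x, m (next t) x = \sum_(y < n) m (now t) y * pi t y x) /\
        (forall x, m ord0 x = m0 d 0 x),
      (forall s, row s gamma \in subdifferential dot (F d s) (row s m)) &
      (forall t, P 0 t \in
         subdifferential (fun g v : R => g * v) (phi d t) (demand m pi t))].

(* m1 = m_1[eps, pi]; these equations determine m1. *)
Definition perturbed_flow (e1 : 'M[R]_(T.+1, n))
    (pi : {ffun 'I_T -> 'M[R]_n}) (m1 : 'M[R]_(T.+1, n)) : Prop :=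
  (forall x, m1 ord0 x - e1 ord0 x = m0 d 0 x) /\
  (forall t x, m1 (next t) x
     = \sum_(y < n) m1 (now t) y * pi t y x - e1 (next t) x).

(* Euclidean norm of (eps_1, eps_2, eps_3); the norm of MathComp-Analysis on
   matrices is the sup norm. *)
Definition K_norm (e1 e2 : 'M[R]_(T.+1, n)) (e3 : 'rV[R]_T) : R :=
  Num.sqrt (\sum_(s < T.+1) \sum_(x < n) e1 s x ^+ 2 +
            \sum_(s < T.+1) \sum_(x < n) e2 s x ^+ 2 +
            \sum_(t < T) e3 0 t ^+ 2).

Definition qualification : Prop :=
  exists2 alpha0 : R, 0 < alpha0 &
  forall (e1 e2 : 'M[R]_(T.+1, n)) (e3 : 'rV[R]_T),
    K_norm e1 e2 e3 <= alpha0 ->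
    exists (pi : {ffun 'I_T -> 'M[R]_n}) (m1 : 'M[R]_(T.+1, n)),
      [/\ (forall t x, row x (pi t) \in edom (ell d t x)),
          perturbed_flow e1 pi m1,
          (forall s x, 0 <= m1 s x),
          (forall s, row s (m1 + e2) \in edom (F d s)) &
          (forall t, demand m1 pi t + e3 0 t \in edom (phi d t))].

End MFG.

(* Main.v *)
Require Import Defs.
From mathcomp Require Import all_boot all_order all_algebra.
From mathcomp Require Import all_classical all_reals all_analysis.
From mathcomp Require Import ring lra.
Set Implicit Arguments.
Unset Strict Implicit.
Unset Printing Implicit Defensive.
Import Order.TTheory GRing.Theory Num.Theory.
Import numFieldNormedType.Exports.
(* [next] must denote the next time step, not the successor in a cycle. *)
Import Defs.
Local Open Scope classical_set_scope.
Local Open Scope ring_scope.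

(** The system is the optimality system of a convex control problem, and the
    argument rests on one identity. Fix prices [gamma] and [P] and replace the
    couplings [F] and [phi] by linear functions with these slopes. If [u] has
    the terminal value [gamma] at time [T], then summation by parts along a
    flow [m] with kernel [pi] ([linearized_cost_gap]) gives
      linearized cost of (m, pi) = <m0, u(0)> + sum of m * gap,
    where the gap is the slack of the row pi(t, x, .) in the Bellman equation.
    If [u] solves that equation the gaps are nonnegative, and they vanish at
    optimal rows.

    Uniqueness. Each solution therefore minimizes the linearized cost at its own
    prices, in particular against the flow of another solution. Adding the two
    resulting inequalities bounds by 0 a sum of the terms
    <g - g', x - x'> with g, g' subgradients of a convex function at x, x'. Such
    terms are nonnegative, hence all vanish, and then g is also a subgradient at
    x' ([subdifferential_transfer]). A differentiable function has only one
    subgradient there, so g = g'. Thus the prices agree, and so does [u] by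
    backward induction. With [u], [gamma] and [P] common to both solutions,
    strict convexity of [ell] makes the minimizer in the Bellman equation
    unique, so the kernels agree, and then so do the flows.

    Existence. The criterion
      sum of m * ell(pi) + sum of F(m) + sum of phi(demand)
    is a lower semicontinuous function of the kernel on a product of simplices,
    so it has a minimizer ([potential_minimizer]). In the variables
    (m, m * pi) it is convex ([flow_mixture]); differentiating along segments
    shows that the minimizer also minimizes the criterion linearized at its own
    gradients ([potential_min_linearized]). Take these gradients as [gamma] and
    [P] and compute [u] by dynamic programming. Comparing with the flow of a
    dynamic programming kernel, whose gaps all vanish, the identity forces the
    gap of the minimizer to vanish at every state of positive mass. At states
    of zero mass the kernel can be replaced by the dynamic programming one,
    which changes neither the flow nor the demand; the result solves the
    system. *)

(** * Lower semicontinuous functions *)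

Lemma adde_gtNy (R : realType) (a b : \bar R) :
  (-oo < a)%E -> (-oo < b)%E -> (-oo < a + b)%E.
Proof. by case: a => // [a|]; case: b => [b| |] // _ _; rewrite ltNyr. Qed.

Lemma sum_gtNy (R : realType) (I : Type) (r : seq I) (f : I -> \bar R) :
  (forall i, (-oo < f i)%E) -> (-oo < \sum_(i <- r) f i)%E.
Proof. by move=> f0; elim/big_ind: _ => // a b; exact: adde_gtNy. Qed.

Section LowerSemicontinuity.
Context {R : realType} {X : topologicalType}.
Implicit Types f g : X -> \bar R.

Lemma lsc_comp (Y : topologicalType) (h : Y -> X) f :
  continuous h -> lower_semicontinuous f -> lower_semicontinuous (f \o h).
Proof.
move=> hc lf y a /lf[V nV fV]; exists (h @^-1` V); first exact: hc.
by move=> z /fV.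
Qed.

Lemma lsc_EFin (h : X -> R) :
  continuous h -> lower_semicontinuous (fun x => (h x)%:E).
Proof.
move=> hc x a; rewrite lte_fin => ah.
exists [set y | a < h y]; last by move=> y; rewrite lte_fin.
exact: (cvgr_gt _ (hc x)).
Qed.

Lemma lsc_add f g :
  (forall x, (-oo < f x)%E) -> (forall x, (-oo < g x)%E) ->
  lower_semicontinuous f -> lower_semicontinuous g ->
  lower_semicontinuous (fun x => f x + g x)%E.
Proof.
move=> f0 g0 lf lg x a afg.
suff [b [c [bf cg abc]]] :
    exists b c : R, [/\ (b%:E < f x)%E, (c%:E < g x)%E & a <= b + c].
  have [V nV fV] := lf _ _ bf; have [W nW gW] := lg _ _ cg.
  exists (V `&` W); first exact: filterI.
  move=> y [/fV byf /gW cyg].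
  by apply: (le_lt_trans _ (lteD byf cyg)); rewrite lee_fin.
have below (e : \bar R) : (-oo < e)%E -> exists c : R, (c%:E < e)%E.
  case: e => [r| |] // _; first by exists (r - 1); rewrite lte_fin; lra.
  by exists 0; rewrite ltry.
have [c cg] := below _ (g0 x); have [b bf] := below _ (f0 x).
move: (f0 x) (g0 x) afg cg bf.
case: (f x) => [r| |] // _; case: (g x) => [s| |] // _ afg cg bf.
- move: afg; rewrite -EFinD lte_fin => afg.
  exists (r - (r + s - a) / 2), (s - (r + s - a) / 2).
  by rewrite !lte_fin; split; lra.
- by exists b, (a - b); split => //; [rewrite ltry|lra].
- by exists (a - c), c; split => //; [rewrite ltry|lra].
- by exists (a - c), c; split => //; [rewrite ltry|lra].
Qed.

Lemma lsc_sum (I : Type) (r : seq I) (f : I -> X -> \bar R) :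
  (forall i x, (-oo < f i x)%E) -> (forall i, lower_semicontinuous (f i)) ->
  lower_semicontinuous (fun x => \sum_(i <- r) f i x)%E.
Proof.
move=> f0 lf; elim: r => [|i r IHr].
  rewrite (_ : (fun _ => _) = (fun=> 0%:E)); last first.
    by apply/funext => x; rewrite big_nil.
  by apply: lsc_EFin => x; exact: cvg_cst.
rewrite (_ : (fun _ => _) = (fun x => f i x + \sum_(j <- r) f j x)%E); last first.
  by apply/funext => x; rewrite big_cons.
by apply: lsc_add => // x; exact: sum_gtNy.
Qed.

(** Where the weight [w] vanishes the product is [0], whatever the value of [f]
    there; the uniform lower bound on [f] keeps [w * f] from dropping below [0]
    in the limit. *)
Lemma lsc_weighted (w : X -> R) (c : R) f :
  continuous w -> (forall x, 0 <= w x) -> (forall x, (c%:E <= f x)%E) ->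
  lower_semicontinuous f ->
  lower_semicontinuous (fun x => (w x)%:E * f x)%E.
Proof.
move=> wc w0 cf lf x a; have := w0 x.
rewrite le_eqVlt => /orP[/eqP w0x|wx].
  rewrite -w0x mul0e lte_fin => a0.
  exists [set y | a < w y * c].
    have wcc : w y * c @[y --> x] --> w x * c by apply: cvgMl; exact: wc.
    by apply: (cvgr_gt _ wcc); rewrite -w0x mul0r.
  move=> y ay; apply: (@lt_le_trans _ _ (w y * c)%:E); first by rewrite lte_fin.
  by rewrite EFinM; apply: lee_wpmul2l; rewrite ?lee_fin.
move=> awf.
have [b bf ab] : exists2 b : R, (b%:E < f x)%E & a < w x * b.
  move: awf (cf x); case: (f x) => [r| |] //.
    rewrite -EFinM lte_fin => ar _; exists ((a / w x + r) / 2).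
      rewrite lte_fin; have : a / w x < r by rewrite ltr_pdivrMr // mulrC.
      by lra.
    have -> : w x * ((a / w x + r) / 2) = (a + w x * r) / 2.
      by field; rewrite gt_eqF.
    by lra.
  move=> _ _; exists ((a + 1) / w x); first by rewrite ltry.
  by rewrite mulrC divfK ?gt_eqF //; lra.
have [V nV fV] := lf _ _ bf.
exists (V `&` [set y | a < w y * b]).
  apply: filterI => //.
  have wcb : w y * b @[y --> x] --> w x * b by apply: cvgMl; exact: wc.
  exact: (cvgr_gt _ wcb).
move=> y [/fV /ltW bfy ay]; apply: (@lt_le_trans _ _ (w y * b)%:E).
  by rewrite lte_fin.
by rewrite EFinM; apply: lee_wpmul2l; rewrite ?lee_fin.
Qed.

(** Otherwise every point of [K] has a neighbourhood on which [f] exceeds some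
    fixed value of [f] on [K]; by compactness one such value would lie below
    [f] on all of [K], including itself. *)
Lemma lsc_attains_min (K : set X) f :
  compact K -> K !=set0 -> lower_semicontinuous f ->
  exists2 x, K x & forall y, K y -> (f x <= f y)%E.
Proof.
move=> /compact_near_coveringP cK [x0 Kx0] lf; apply: contrapT => nomin.
have below x : K x -> exists2 y, K y & (f y < f x)%E.
  move=> Kx; apply: contrapT => nx; apply: nomin; exists x => // y Ky.
  by rewrite leNgt; apply/negP => fyx; apply: nx; exists y.
pose G := filter_from K (fun y => [set z | K z /\ (f z <= f y)%E]).
have FG : Filter G.
  apply: filter_from_filter; first by exists x0.
  move=> y z Ky Kz; have [fyz|/ltW fzy] := leP (f y) (f z).
    by exists y => // t [Kt fty]; split; split => //; exact: le_trans fyz.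
  by exists z => // t [Kt fty]; split; split => //; exact: le_trans fzy.
have [|y Ky /(_ y)] := cK X G (fun z x => f z < f x)%E FG.
  move=> x Kx; have [y Ky fyx] := below _ Kx.
  have [a fya afx] : exists2 a : R, (f y <= a%:E)%E & (a%:E < f x)%E.
    move: fyx; case: (f y) => [r| |].
    - by move=> ?; exists r.
    - by rewrite ltNge leey.
    - case: (f x) => [s _| _|] //; last by exists 0; rewrite ?ltry ?leNye.
      by exists (s - 1); rewrite ?leNye // lte_fin; lra.
  have [V nV fV] := lf _ _ afx.
  exists (V, [set z | K z /\ (f z <= f y)%E]); first by split => //=; exists y.
  move=> [x' z] [/= /fV ax' [_ fzy]].
  exact: le_lt_trans (le_trans fzy fya) ax'.
by move=> /(_ (conj Ky (lexx _)))/(_ y Ky); rewrite ltxx.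
Qed.

End LowerSemicontinuity.

(** * Convex functions and gradients *)

Section Gradient.
Context {R : realType} {V : normedModType R}.
Implicit Types (f : V -> \bar R) (x y h : V).

Lemma cvg_at_right_derive (k : V -> R^o) x h : derivable k x h ->
  l^-1 * (k (x + l *: h) - k x) @[l --> 0^'+] --> ('D_h k x : R).
Proof.
move=> dk; apply: cvg_dnbhs_at_right; rewrite /derive.
have -> : (fun l : R => l^-1 * (k (x + l *: h) - k x)) =
    (fun l => l^-1 *: ((k \o shift x) (l *: h) - k x)).
  by apply/funext => l /=; rewrite [l *: h + x]addrC.
exact: dk.
Qed.

Lemma econvex_fine f x y (a b : R) : (forall x, (-oo < f x)%E) -> econvex f ->
  x \in edom f -> y \in edom f -> 0 <= a -> 0 <= b -> a + b = 1 ->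
  a *: x + b *: y \in edom f /\
  fine (f (a *: x + b *: y)) <= a * fine (f x) + b * fine (f y).
Proof.
move=> f0 cf; rewrite !inE /edom /=.
rewrite le_eqVlt => xd yd /orP[/eqP <-|a0].
  by rewrite add0r => _ ->; rewrite scale0r add0r scale1r mul0r add0r mul1r.
rewrite le_eqVlt => /orP[/eqP <-|b0].
  by rewrite addr0 => ->; rewrite scale0r addr0 scale1r mul0r addr0 mul1r.
move=> ab; have a1 : 0 < a < 1 by apply/andP; split => //; lra.
have := cf x y a a1; have -> : 1 - a = b by lra.
move: (f0 x) (f0 y) (f0 (a *: x + b *: y)) xd yd.
case: (f x) => [r| |] // _; case: (f y) => [s| |] // _.
by case: (f (_ + _)) => [t| |] // _ _ _; rewrite ltry -!EFinM -EFinD lee_fin.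
Qed.

Context (f : V -> \bar R) (df : edifferentiable f).
Let k : V -> R^o := fun y => fine (f y).

Lemma edifferentiable_derivable x h : derivable k x h.
Proof. by apply: diff_derivable; have [_] := df; exact. Qed.

Lemma cvg_quotient x h :
  l^-1 * (fine (f (x + l *: h)) - fine (f x)) @[l --> 0^'+]
    --> ('D_h k x : R).
Proof. exact: (cvg_at_right_derive (@edifferentiable_derivable x h)). Qed.

(** For a convex function the difference quotient along a segment is at most its
    value at the far end. *)
Lemma econvex_ge_derive x y : econvex f ->
  ('D_(y - x) k x : R) <= fine (f y) - fine (f x).
Proof.
move=> cf; apply: (cvgr_to_le (@cvg_quotient x (y - x))).
near=> l.
have l0 : 0 < l by near: l; exact: nbhs_right_gt.
have l1 : l < 1 by near: l; exact: nbhs_right_lt.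
rewrite mulrC ler_pdivrMr // lerBlDr.
have [fin _] := df.
have gtNy z : (-oo < f z)%E by have := fin z; rewrite fin_numElt => /andP[].
have dom z : z \in edom f.
  by rewrite inE /edom /=; have := fin z; rewrite fin_numElt => /andP[].
have l1' : 0 <= 1 - l by lra.
have [_] := econvex_fine gtNy cf (dom y) (dom x) (ltW l0) l1' (subrKC l 1).
have -> : l *: y + (1 - l) *: x = x + l *: (y - x).
  by rewrite scalerBr scalerBl scale1r addrCA addrA.
lra.
Unshelve. all: by end_near.
Qed.

Context (ip : V -> V -> R).
Hypothesis ipl : forall g c h, ip g (c *: h) = c * ip g h.

Lemma subdifferential_gradient x g : econvex f ->
  (forall h, ip g h = 'D_h k x) -> subdifferential ip f x g.
Proof.
move=> cf gh; have [fin _] := df; split; first exact: fin.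
move=> y; rewrite -(fineK (fin x)) -(fineK (fin y)) -EFinD lee_fin gh.
by have := econvex_ge_derive x y cf; lra.
Qed.

(** The subgradient inequality at [x + l *: h] bounds the slope in direction [h]
    by the derivative; linearity turns the same bound for [- h] into the reverse
    inequality. Hence a differentiable function has at most one subgradient. *)
Lemma subgradient_derive x g h : subdifferential ip f x g ->
  ip g h = 'D_h k x.
Proof.
move=> [_ sub]; have [fin _] := df.
have le h' : ip g h' <= 'D_h' k x.
  apply: (cvgr_to_ge (@cvg_quotient x h')); near=> l.
  have l0 : 0 < l by near: l; exact: nbhs_right_gt.
  rewrite mulrC ler_pdivlMr // mulrC -ipl.
  move: (sub (x + l *: h')); rewrite addrAC subrr add0r.
  by rewrite -(fineK (fin x)) -(fineK (fin (_ + _))) -EFinD lee_fin; lra.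
apply/eqP; rewrite eq_le le /=.
have := le (- h); rewrite -scaleN1r ipl !mulN1r.
rewrite deriveE; last by case: df.
rewrite linearZ/= -deriveE; last by case: df.
by rewrite scaleN1r lerN2.
Unshelve. all: by end_near.
Qed.

End Gradient.

Section Subgradients.
Context {R : realType} {n : nat}.
Implicit Types g h : 'rV[R]_n.

Lemma dotZr g (c : R) h : dot g (c *: h) = c * dot g h.
Proof. by rewrite /dot mulr_sumr; apply: eq_bigr => i _; rewrite mxE mulrCA. Qed.

Lemma dotBr g h1 h2 : dot g (h1 - h2) = dot g h1 - dot g h2.
Proof.
rewrite /dot -sumrB; apply: eq_bigr => i _.
by rewrite !mxE mulrBr.
Qed.

Lemma dot_inj g g' : (forall h, dot g h = dot g' h) -> g = g'.
Proof.
have dotE u i : dot u (delta_mx 0 i : 'rV[R]_n) = u 0 i.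
  rewrite /dot (bigD1 i) //= mxE !eqxx mulr1 big1 ?addr0 // => j ji.
  by rewrite mxE eqxx (negbTE ji) mulr0.
by move=> e; apply/rowP => i; rewrite -!dotE e.
Qed.

(** The gradient is the vector that represents the differential. *)
Lemma linear_dot (L : {linear 'rV[R]_n -> R^o}) :
  exists g, forall h, dot g h = L h.
Proof.
exists (\row_i L (delta_mx 0 i)) => h.
rewrite [in RHS](row_sum_delta h) linear_sum.
by apply: eq_bigr => i _; rewrite linearZ mxE mulrC.
Qed.

End Subgradients.

Section Monotonicity.
Context {R : realType} {V : zmodType} (ip : V -> V -> R) (f : V -> \bar R).
Hypothesis ipB : forall g x y, ip g (x - y) = ip g x - ip g y.

Lemma subdifferential_monotone g g' x x' :
  subdifferential ip f x g -> subdifferential ip f x' g' ->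
  ip g x' + ip g' x <= ip g x + ip g' x'.
Proof.
move=> [fx /(_ x') +] [fx' /(_ x)].
rewrite -(fineK fx) -(fineK fx') -!EFinD !lee_fin !ipB; lra.
Qed.

(** Equality in the monotonicity inequality puts [(x', f x')] on the graph of the
    affine function of slope [g] that supports [f] at [x], so this function also
    supports [f] at [x']. *)
Lemma subdifferential_transfer g g' x x' :
  subdifferential ip f x g -> subdifferential ip f x' g' ->
  ip g x + ip g' x' <= ip g x' + ip g' x -> subdifferential ip f x' g.
Proof.
move=> [fx gx] [fx' /(_ x) gx'] le; split=> // y; apply: le_trans (gx y).
move: gx'; rewrite -(fineK fx) -(fineK fx') -!EFinD !lee_fin !ipB; lra.
Qed.

End Monotonicity.

(** * Recursion over the time steps *)

Section Time.
Context {T : nat}.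

Lemma time_ind (Q : 'I_T.+1 -> Prop) :
  Q ord0 -> (forall t : 'I_T, Q (now t) -> Q (next t)) -> forall s, Q s.
Proof.
move=> Q0 QS [s]; elim: s => [|s IHs] sT.
  by rewrite (_ : Ordinal _ = ord0) //; exact: val_inj.
rewrite (_ : Ordinal sT = next (Ordinal (sT : (s < T)%N))); last exact: val_inj.
by apply: QS; rewrite (_ : now _ = Ordinal (ltnW sT)) //; exact: val_inj.
Qed.

Lemma rev_now (t : 'I_T) : rev_ord (now t) = next (rev_ord t).
Proof. by apply: val_inj; rewrite /= subSS /bump /= add1n subnSK. Qed.

Lemma rev_next (t : 'I_T) : rev_ord (next t) = now (rev_ord t).
Proof. by apply: val_inj; rewrite /= /bump /= add1n. Qed.

Lemma time_ind_backward (Q : 'I_T.+1 -> Prop) :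
  Q ord_max -> (forall t : 'I_T, Q (next t) -> Q (now t)) -> forall s, Q s.
Proof.
move=> QT QS s; rewrite -[s]rev_ordK.
move: (rev_ord s); apply: time_ind => [|t].
  by rewrite (_ : rev_ord ord0 = ord_max) //; apply: val_inj; rewrite /= subn1.
by rewrite rev_now rev_next; exact: QS.
Qed.

(** The recursion runs over [nat], and [insub] recovers the time step. The
    default [x0] is only reached past the horizon. *)
Fixpoint time_iter {X : Type} (x0 : X) (step : 'I_T -> X -> X) (k : nat) : X :=
  if k is k'.+1 then
    if insub k' is Some t then step t (time_iter x0 step k') else x0
  else x0.

Lemma time_iter_next {X : Type} (x0 : X) (step : 'I_T -> X -> X) (t : 'I_T) :
  time_iter x0 step (next t) = step t (time_iter x0 step (now t)).
Proof. by rewrite lift0 /= valK. Qed.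

Lemma backward_iterP {X : Type} (xT : X) (step : 'I_T -> X -> X) :
  exists v : 'I_T.+1 -> X,
    v ord_max = xT /\ forall t, v (now t) = step t (v (next t)).
Proof.
exists (fun s => time_iter xT (fun t => step (rev_ord t)) (rev_ord s)).
split=> [|t]; first by rewrite /= subnn.
by rewrite rev_now time_iter_next rev_ordK -rev_next.
Qed.

End Time.

(** * Flows and the linearized cost *)

Section Flow.
Context {R : realType} {T n : nat} (d : mfg_data R T n).
Implicit Types (m u gamma : 'M[R]_(T.+1, n)) (pi : {ffun 'I_T -> 'M[R]_n}).
Implicit Types (P : 'rV[R]_T).

Definition is_flow pi m : Prop :=
  (forall t x, m (next t) x = \sum_(y < n) m (now t) y * pi t y x) /\
  (forall x, m ord0 x = m0 d 0 x).

Definition flow pi : 'M[R]_(T.+1, n) :=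
  \matrix_(s, x) time_iter (m0 d)
    (fun t v => \row_z \sum_(y < n) v 0 y * pi t y z) s 0 x.

Lemma flowP pi : is_flow pi (flow pi).
Proof.
split=> [t x|x]; last by rewrite mxE.
by rewrite mxE time_iter_next mxE; apply: eq_bigr => y _; rewrite !mxE.
Qed.

Lemma is_flow_uniq pi m m' : is_flow pi m -> is_flow pi m' -> m = m'.
Proof.
move=> [mS m0E] [mS' m0E'].
suff e s : forall x, m s x = m' s x by apply/matrixP => s x; exact: e.
move: s; apply: time_ind => [x|t IH x]; first by rewrite m0E m0E'.
by rewrite mS mS'; apply: eq_bigr => y _; rewrite IH.
Qed.

Lemma is_flow_ge0 pi m : m0 d \in simplex n ->
  (forall t x, row x (pi t) \in simplex n) -> is_flow pi m ->
  forall s x, 0 <= m s x.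
Proof.
rewrite inE => -[m0_ge0 _] spi [mS m0E]; apply: time_ind => [x|t IH x].
  by rewrite m0E; have /andP[] := m0_ge0 x.
rewrite mS; apply: sumr_ge0 => y _; apply: mulr_ge0; first exact: IH.
have := spi t y; rewrite inE => -[/(_ x) + _].
by rewrite mxE => /andP[].
Qed.

(** The kernel enters the flow and the demand only through [m * pi]. This is what
    allows the kernel of a minimizer to be corrected where [m] vanishes. *)
Lemma eq_on_occupied_flow pi pi' m : is_flow pi m ->
  (forall t x, m (now t) x != 0 -> row x (pi t) = row x (pi' t)) ->
  is_flow pi' m /\ (forall t, demand d m pi t = demand d m pi' t).
Proof.
move=> [mS m0E] e.
have eE t x y : m (now t) x * pi t x y = m (now t) x * pi' t x y.
  have [->|/e/rowP/(_ y)] := eqVneq (m (now t) x) 0; first by rewrite !mul0r.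
  by rewrite !mxE => ->.
split; first by split=> // t x; rewrite mS; apply: eq_bigr => y _; rewrite eE.
by move=> t; apply: eq_bigr => x _; apply: eq_bigr => y _; rewrite eE.
Qed.

Definition running_cost m pi : R :=
  \sum_(t < T) \sum_(x < n) m (now t) x * fine (ell d t x (row x (pi t))).

(** The excess over [u] of the cost of playing [rho] at [(t, x)], that is, the
    slack in the Bellman equation. *)
Definition gap u gamma P (t : 'I_T) (x : 'I_n) (rho : 'rV[R]_n) : R :=
  fine (ell d t x rho) + (gamma (now t) x +
    \sum_(y < n) rho 0 y * (alpha d t x y * P 0 t + u (next t) y))
  - u (now t) x.

(** The criterion with [F] and [phi] replaced by linear functions of slopes
    [gamma] and [P]. *)
Definition linearized_cost gamma P m pi : R :=
  running_cost m pi + \sum_(s < T.+1) dot (row s gamma) (row s m)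
  + \sum_(t < T) P 0 t * demand d m pi t.

(** Summing the gaps against [m] and using the flow equation, the terms
    [m (next t) * u (next t)] and [m (now t) * u (now t)] telescope in time: the
    initial one remains, and the final one is the terminal cost. *)
Lemma linearized_cost_gap u gamma P m pi : is_flow pi m ->
  (forall x, u ord_max x = gamma ord_max x) ->
  linearized_cost gamma P m pi = \sum_(x < n) m0 d 0 x * u ord0 x +
    \sum_(t < T) \sum_(x < n) m (now t) x * gap u gamma P t x (row x (pi t)).
Proof.
move=> [mS m0E] uT.
pose A s := \sum_(x < n) m s x * u s x.
pose G s := dot (row s gamma) (row s m).
pose L t := \sum_(x < n) m (now t) x * fine (ell d t x (row x (pi t))).
(* [A] is the pairing that telescopes. *)
have gapE t : \sum_(x < n) m (now t) x * gap u gamma P t x (row x (pi t)) =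
    L t + G (now t) + P 0 t * demand d m pi t + A (next t) - A (now t).
  have -> : A (next t) = \sum_(x < n) \sum_(y < n)
      m (now t) x * pi t x y * u (next t) y.
    rewrite exchange_big; apply: eq_bigr => y _.
    by rewrite mS mulr_suml.
  rewrite /L /G /dot /demand mulr_sumr -!big_split -sumrB; apply: eq_bigr => x _.
  rewrite /gap !mxE mulrBr !mulrDr mulr_sumr [P 0 t * _]mulr_sumr.
  rewrite [gamma _ _ * _]mulrC -!addrA; do 2!congr (_ + _).
  rewrite !addrA -big_split; congr (_ - _); apply: eq_bigr => y _ /=.
  by rewrite !mxE; ring.
rewrite (eq_bigr _ (fun t _ => gapE t)) sumrB !big_split /=.
have GT : \sum_s G s = \sum_t G (now t) + G ord_max by rewrite big_ord_recr.
have AE : \sum_t A (now t) + A ord_max = A ord0 + \sum_t A (next t).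
  by transitivity (\sum_s A s); [rewrite big_ord_recr|rewrite big_ord_recl].
rewrite /linearized_cost /running_cost -/(\sum_t L t) -/(\sum_s G s) GT.
have -> : \sum_(x < n) m0 d 0 x * u ord0 x = A ord0.
  by apply: eq_bigr => x _; rewrite m0E.
have -> : G ord_max = A ord_max.
  by apply: eq_bigr => x _; rewrite !mxE uT mulrC.
lra.
Qed.

Lemma bellman_costE u gamma P t x rho : ell d t x rho \is a fin_num ->
  bellman_cost d u gamma P t x rho = (gap u gamma P t x rho + u (now t) x)%:E.
Proof.
move=> fin; rewrite /bellman_cost -[ell _ _ _ _]fineK // -EFinD /gap.
by rewrite subrK.
Qed.

End Flow.

(** * Uniqueness *)

Section Uniqueness.
Context {R : realType} {T n : nat} (d : mfg_data R T n).
Hypothesis hstanding : standing_assumption d.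
Implicit Types (m u gamma : 'M[R]_(T.+1, n)) (pi : {ffun 'I_T -> 'M[R]_n}).
Implicit Types (P : 'rV[R]_T).

Lemma ell_fin_num t x rho : rho \in edom (ell d t x) ->
  ell d t x rho \is a fin_num.
Proof.
have [_ /(_ t x)[[gtNy _] _ _ _] _ _] := hstanding.
by rewrite inE fin_numElt gtNy.
Qed.

Lemma edom_simplex t x rho : rho \in edom (ell d t x) -> rho \in simplex n.
Proof.
by have [_ /(_ t x)[_ _ _ sub] _ _] := hstanding; rewrite !inE; exact: sub.
Qed.

Lemma bellman_gap_ge0 u gamma P t x rho :
  (u (now t) x)%:E = bellman_value d u gamma P t x ->
  rho \in edom (ell d t x) -> 0 <= gap d u gamma P t x rho.
Proof.
move=> uE dr.
have : (bellman_value d u gamma P t x <= bellman_cost d u gamma P t x rho)%E.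
  apply: ereal_inf_lbound; exists rho => //.
  by have := edom_simplex dr; rewrite inE.
by rewrite -uE (bellman_costE _ _ _ (ell_fin_num dr)) lee_fin; lra.
Qed.

Lemma bellman_gap_eq0 u gamma P t x rho :
  (u (now t) x)%:E = bellman_value d u gamma P t x ->
  rho \in edom (ell d t x) ->
  bellman_cost d u gamma P t x rho = bellman_value d u gamma P t x <->
  gap d u gamma P t x rho = 0.
Proof.
move=> uE dr; rewrite -uE (bellman_costE _ _ _ (ell_fin_num dr)).
by split=> [[]|->]; [lra|rewrite add0r].
Qed.

Lemma MFG_gap m pi u gamma P : MFG d (MFGVars m pi u gamma P) ->
  [/\ is_flow d pi m, forall t x, row x (pi t) \in edom (ell d t x),
      forall t x, gap d u gamma P t x (row x (pi t)) = 0 &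
      forall t x rho, rho \in edom (ell d t x) ->
        0 <= gap d u gamma P t x rho].
Proof.
move=> [[uE uT] opt mE _ _].
have dom t x : row x (pi t) \in edom (ell d t x).
  have [_] := opt t x; rewrite -uE /bellman_cost inE /edom /=.
  by case: (ell _ _ _ _) => // r _; rewrite ltry.
split=> // t x; last by move=> rho; exact: bellman_gap_ge0.
by apply/(bellman_gap_eq0 (uE t x) (dom t x)); have [_] := opt t x.
Qed.

(** The kernel of a solution is an optimal control for the criterion frozen at
    its own prices [gamma] and [P]. *)
Lemma MFG_linearized_min m pi u gamma P m' pi' :
  MFG d (MFGVars m pi u gamma P) -> is_flow d pi' m' ->
  (forall t x, row x (pi' t) \in edom (ell d t x)) ->
  linearized_cost d gamma P m pi <= linearized_cost d gamma P m' pi'.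
Proof.
move=> sol flow' dom'; have [[_ uT] _ _ _ _] := sol.
have [flow_m dom gap0 gap_ge0] := MFG_gap sol.
rewrite (linearized_cost_gap P flow_m uT) (linearized_cost_gap P flow' uT).
rewrite lerD2l [leLHS]big1; last first.
  by move=> t _; rewrite big1 // => x _; rewrite gap0 mulr0.
have m0S : m0 d \in simplex n by case: hstanding.
apply: sumr_ge0 => t _; apply: sumr_ge0 => x _.
apply: mulr_ge0; last exact: gap_ge0.
apply: is_flow_ge0 flow' _ _ => // {}t {}x.
exact: edom_simplex.
Qed.

Lemma eq_bellman_value u u' gamma P t x :
  (forall y, u (next t) y = u' (next t) y) ->
  bellman_value d u gamma P t x = bellman_value d u' gamma P t x.
Proof.
move=> uu'; congr (ereal_inf (image _ _)); apply/funext => rho.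
rewrite /bellman_cost; congr (_ + (_ + _)%:E)%E.
by apply: eq_bigr => y _; rewrite uu'.
Qed.

Lemma bellman_value_uniq u u' gamma P :
  (forall t x, (u (now t) x)%:E = bellman_value d u gamma P t x) ->
  (forall t x, (u' (now t) x)%:E = bellman_value d u' gamma P t x) ->
  (forall x, u ord_max x = u' ord_max x) -> u = u'.
Proof.
move=> uE uE' uT.
suff e s : forall x, u s x = u' s x by apply/matrixP => s x; exact: e.
move: s; apply: time_ind_backward => // t IH x.
by apply: EFin_inj; rewrite uE uE'; exact: eq_bellman_value.
Qed.

Hypothesis hF : forall s, edifferentiable (F d s).
Hypothesis hphi : forall t, edifferentiable (phi d t : R^o -> \bar R).

(** Each solution is optimal at its own prices, so the duality pairing of the
    difference of the prices with the difference of the masses and demands is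
    nonpositive; monotonicity of subdifferentials makes every term zero. *)
Lemma MFG_prices_uniq m pi u gamma P m' pi' u' gamma' P' :
  MFG d (MFGVars m pi u gamma P) -> MFG d (MFGVars m' pi' u' gamma' P') ->
  gamma = gamma' /\ P = P'.
Proof.
move=> sol sol'.
have [flow_m dom _ _] := MFG_gap sol; have [flow' dom' _ _] := MFG_gap sol'.
have le := MFG_linearized_min sol flow' dom'.
have le' := MFG_linearized_min sol' flow_m dom.
have [_ _ _ gF gphi] := sol; have [_ _ _ gF' gphi'] := sol'.
pose a s := dot (row s gamma) (row s m) + dot (row s gamma') (row s m') -
  (dot (row s gamma) (row s m') + dot (row s gamma') (row s m)).
pose D := demand d m pi; pose D' := demand d m' pi'.
pose b t := P 0 t * D t + P' 0 t * D' t - (P 0 t * D' t + P' 0 t * D t).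
have mulB (g x y : R) : g * (x - y) = g * x - g * y by exact: mulrBr.
have a0 s : 0 <= a s.
  move: (gF s) (gF' s); rewrite !inE => gs gs'; rewrite subr_ge0.
  exact: (subdifferential_monotone (@dotBr _ _) gs gs').
have b0 t : 0 <= b t.
  move: (gphi t) (gphi' t); rewrite !inE => gs gs'; rewrite subr_ge0.
  exact: (subdifferential_monotone mulB gs gs').
(* The running costs cancel in the sum of the two inequalities. *)
have sab : \sum_s a s + \sum_t b t <= 0.
  rewrite /a /b !sumrB !big_split /=; move: le le'.
  by rewrite /linearized_cost /D /D'; lra.
have sa0 : 0 <= \sum_s a s by exact: sumr_ge0.
have sb0 : 0 <= \sum_t b t by exact: sumr_ge0.
have aE s : a s = 0.
  have sa : \sum_s a s = 0 by lra.
  exact: (psumr_eq0P (fun s _ => a0 s) sa).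
have bE t : b t = 0.
  have sb : \sum_t b t = 0 by lra.
  exact: (psumr_eq0P (fun s _ => b0 s) sb).
split.
  apply/row_matrixP => s; apply: dot_inj => h.
  move: (gF s) (gF' s); rewrite !inE => gs gs'.
  have le_s : dot (row s gamma) (row s m) + dot (row s gamma') (row s m') <=
      dot (row s gamma) (row s m') + dot (row s gamma') (row s m).
    by rewrite -subr_le0 -/(a s) aE.
  have gm' := subdifferential_transfer (@dotBr _ _) gs gs' le_s.
  rewrite (subgradient_derive (hF s) (@dotZr _ _) h gm').
  by rewrite (subgradient_derive (hF s) (@dotZr _ _) h gs').
apply/rowP => t.
move: (gphi t) (gphi' t); rewrite !inE => gs gs'.
have le_t : P 0 t * D t + P' 0 t * D' t <= P 0 t * D' t + P' 0 t * D t.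
  by rewrite -subr_le0 -/(b t) bE.
have gm' := subdifferential_transfer mulB gs gs' le_t.
have mulZ (g c : R) (h : R^o) : g * (c *: h) = c * (g * h) by exact: mulrCA.
have := subgradient_derive (hphi t) mulZ 1 gm'.
by rewrite -(subgradient_derive (hphi t) mulZ 1 gs') !mulr1.
Qed.

Lemma MFG_dual_uniq m pi u gamma P m' pi' u' gamma' P' :
  MFG d (MFGVars m pi u gamma P) -> MFG d (MFGVars m' pi' u' gamma' P') ->
  [/\ u = u', gamma = gamma' & P = P'].
Proof.
move=> sol sol'; have [gE PE] := MFG_prices_uniq sol sol'.
split=> //; move: sol sol' => [[uE uT] _ _ _ _] [[uE' uT'] _ _ _ _].
apply: (@bellman_value_uniq _ _ gamma P) => //.
- by rewrite gE PE.
- by move=> x; rewrite uT uT' gE.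
Qed.

(** Both kernels have zero gap for the same [u], [gamma] and [P]. Were two rows
    distinct, strict convexity would give their midpoint a negative gap. *)
Lemma MFG_primal_uniq m pi m' pi' u gamma P :
  (forall t x, strictly_convex_on_dom (ell d t x)) ->
  MFG d (MFGVars m pi u gamma P) -> MFG d (MFGVars m' pi' u gamma P) ->
  m = m' /\ pi = pi'.
Proof.
move=> sc sol sol'.
have [flow_m dom gap0 gap_ge0] := MFG_gap sol.
have [flow' dom' gap0' _] := MFG_gap sol'.
suff piE : pi = pi' by split=> //; apply: is_flow_uniq flow_m _; rewrite piE.
apply/ffunP => t; apply/row_matrixP => x; apply/eqP/negPn/negP => ne.
have half : 0 < (2^-1 : R) < 1 by lra.
have := sc t x _ _ _ (dom t x) (dom' t x) ne half.
set rho := _ *: _ + _ *: _.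
rewrite -(fineK (ell_fin_num (dom t x))) -(fineK (ell_fin_num (dom' t x))).
rewrite -!EFinM -EFinD => lt.
have dr : rho \in edom (ell d t x).
  by rewrite inE; exact: lt_trans lt (ltry _).
move: lt (gap_ge0 t x _ dr) (gap0 t x) (gap0' t x).
rewrite -(fineK (ell_fin_num dr)) lte_fin /gap.
have -> : \sum_(y < n) rho 0 y * (alpha d t x y * P 0 t + u (next t) y) =
  2^-1 * (\sum_(y < n) row x (pi t) 0 y * (alpha d t x y * P 0 t + u (next t) y)) +
  2^-1 * (\sum_(y < n) row x (pi' t) 0 y * (alpha d t x y * P 0 t + u (next t) y)).
  rewrite !mulr_sumr -big_split; apply: eq_bigr => y _ /=.
  by rewrite /rho !mxE; field.
by lra.
Qed.

End Uniqueness.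

(** * Semicontinuity of the potential *)

Section Continuity.
Context {R : realType} {X : topologicalType}.

Lemma continuous_sumR (I : Type) (r : seq I) (f : I -> X -> R) :
  (forall i, continuous (f i)) -> continuous (fun x => \sum_(i <- r) f i x).
Proof.
by move=> fc x; apply: cvg_big => [|i _]; [exact: add_continuous|exact: fc].
Qed.

Lemma continuous_mulR (f g : X -> R) :
  continuous f -> continuous g -> continuous (fun x => f x * g x).
Proof. by move=> fc gc x; apply: cvgM; [exact: fc|exact: gc]. Qed.

Lemma continuous_coordwise m n (f : X -> 'M[R]_(m, n)) :
  (forall i j, continuous (fun x => f x i j)) -> continuous f.
Proof.
move=> fc x A [B nB BA].
have nbB : \forall y \near x, forall i j, B i j (f y i j).
  apply: filter_forall => i; apply: filter_forall => j.
  by apply: (fc i j x); exact: nB.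
by apply: filterS nbB => y By; apply: BA.
Qed.

End Continuity.

Lemma simplex_compact (R : realType) n : compact (simplex n : set 'rV[R]_n).
Proof.
have -> : (simplex n : set 'rV[R]_n) =
    [set v : 'rV[R]_n | forall i, `[0, 1]%classic (v ord0 i)] `&`
    (fun v : 'rV[R]_n => \sum_(i < n) v 0 i) @^-1` [set x | x = 1].
  by apply/seteqP; split=> v [/= h ?]; split=> //= i; have := h i; rewrite in_itv.
apply: compact_closedI.
  by apply: (@rV_compact R n (fun=> `[0, 1]%classic)) => i; exact: segment_compact.
apply: closed_comp; last exact: closed_eq.
by move=> v _; apply: continuous_sumR => i; exact: coord_continuous.
Qed.

Section Minimizer.
Context {R : realType} {T n : nat} (d : mfg_data R T n).
Hypothesis hstanding : standing_assumption d.
Implicit Types (m : 'M[R]_(T.+1, n)) (pi : {ffun 'I_T -> 'M[R]_n}).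

(** Outside the compact simplex [ell] is infinite, and on it a lower
    semicontinuous function is bounded below. *)
Lemma ell_lower_bound t x : exists c : R, forall rho, (c%:E <= ell d t x rho)%E.
Proof.
have [_ /(_ t x)[[gtNy [r0 dr0]] _ lsc sub] _ _] := hstanding.
have [|r Sr minr] := lsc_attains_min (@simplex_compact R n) _ lsc.
  by exists r0; exact: sub.
have [c cr] : exists c : R, (c%:E <= ell d t x r)%E.
  move: (gtNy r); case: (ell d t x r) => [s| |] // _; first by exists s.
  by exists 0; rewrite leey.
exists c => rho.
have [/sub Srho|nd] := pselect (edom (ell d t x) rho).
  exact: le_trans cr (minr _ Srho).
have -> : ell d t x rho = +oo%E; last by rewrite leey.
by move: nd; rewrite /edom /= ltey => /negP/negPn/eqP.
Qed.

Local Notation controls := {ptws 'I_T * 'I_n -> 'rV[R]_n}.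

(** Controls indexed by pairs carry the product topology, to which Tychonoff's
    theorem applies. *)
Definition kernel_of (q : controls) : {ffun 'I_T -> 'M[R]_n} :=
  [ffun t => \matrix_(x, y) q (t, x) 0 y].

Lemma row_kernel_of q t x : row x (kernel_of q t) = q (t, x).
Proof. by apply/rowP => y; rewrite !(mxE, ffunE). Qed.

Lemma kernel_ofE q t x y : kernel_of q t x y = q (t, x) 0 y.
Proof. by rewrite -row_kernel_of mxE. Qed.

Lemma kernel_of_continuous t x y : continuous (fun q : controls => kernel_of q t x y).
Proof.
rewrite (_ : (fun q : controls => _) = (fun v : 'rV[R]_n => v 0 y) \o proj (t, x)).
  move=> q; apply: continuous_comp; first exact: proj_continuous.
  exact: coord_continuous.
by apply/funext => q /=; rewrite kernel_ofE.
Qed.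

Lemma flow_continuous s x : continuous (fun q : controls => flow d (kernel_of q) s x).
Proof.
move: s x; apply: time_ind => [x|t IH x].
  rewrite (_ : (fun q : controls => _) = fun _ : controls => m0 d 0 x).
    exact: cst_continuous.
  by apply/funext => q; have [_ ->] := flowP d (kernel_of q).
rewrite (_ : (fun q : controls => _) = fun q : controls =>
    \sum_(y < n) flow d (kernel_of q) (now t) y * kernel_of q t y x).
  apply: continuous_sumR => y; apply: continuous_mulR; first exact: IH.
  exact: kernel_of_continuous.
by apply/funext => q; have [-> _] := flowP d (kernel_of q).
Qed.

Lemma demand_continuous t :
  continuous (fun q : controls => demand d (flow d (kernel_of q)) (kernel_of q) t).
Proof.
apply: continuous_sumR => x; apply: continuous_sumR => y.
apply: continuous_mulR; last exact: cst_continuous.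
by apply: continuous_mulR; [exact: flow_continuous|exact: kernel_of_continuous].
Qed.

(** The weights are absolute values because the flow of an arbitrary matrix
    kernel may be negative, whereas semicontinuity is proved on the whole space
    of controls; for stochastic kernels they change nothing. A zero weight
    cancels an infinite [ell]. *)
Definition epotential pi : \bar R :=
  (\sum_(t < T) \sum_(x < n)
     (`|flow d pi (now t) x|)%:E * ell d t x (row x (pi t)) +
   \sum_(s < T.+1) F d s (row s (flow d pi)) +
   \sum_(t < T) phi d t (demand d (flow d pi) pi t))%E.

Lemma weighted_ell_gtNy (w : R) t x rho : 0 <= w ->
  (-oo < w%:E * ell d t x rho)%E.
Proof.
move=> w0; have [c /(_ rho) crho] := ell_lower_bound t x.
apply: (@lt_le_trans _ _ (w * c)%:E); first by rewrite ltNyr.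
by rewrite EFinM; apply: lee_wpmul2l; rewrite ?lee_fin.
Qed.

Lemma lsc_epotential :
  lower_semicontinuous (fun q : controls => epotential (kernel_of q)).
Proof.
have [_ hell hF hphi] := hstanding.
have F_gtNy s rho : (-oo < F d s rho)%E by have [[? _] _ _] := hF s.
have phi_gtNy t x : (-oo < phi d t x)%E by have [[? _] _ _] := hphi t.
apply: lsc_add; [|by move=> q; exact: sum_gtNy| |].
- move=> q; apply: adde_gtNy; apply: sum_gtNy => // t.
  by apply: sum_gtNy => x; exact: weighted_ell_gtNy.
- apply: lsc_add; [|by move=> q; exact: sum_gtNy| |].
  + move=> q; apply: sum_gtNy => t; apply: sum_gtNy => x.
    exact: weighted_ell_gtNy.
  + apply: lsc_sum => t.
      by move=> q; apply: sum_gtNy => x; exact: weighted_ell_gtNy.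
    apply: lsc_sum => x; first by move=> q; exact: weighted_ell_gtNy.
    have [c cell] := ell_lower_bound t x.
    apply: (lsc_weighted (c := c)) => //.
      move=> q; apply: (continuous_comp (@flow_continuous (now t) x q)).
      exact: norm_continuous.
    have [_ _ lsc _] := hell t x.
    rewrite (_ : (fun q : controls => _) = ell d t x \o proj (t, x)).
      by apply: lsc_comp => //; exact: proj_continuous.
    by apply/funext => q /=; rewrite row_kernel_of.
  + apply: lsc_sum => // s; have [_ _ lsc] := hF s.
    apply: (lsc_comp _ lsc); apply: continuous_coordwise => i x.
    rewrite (_ : (fun q : controls => _) = fun q : controls => flow d (kernel_of q) s x).
      exact: flow_continuous.
    by apply/funext => q; rewrite mxE.
- apply: lsc_sum => // t; have [_ _ lsc] := hphi t.
  exact: (lsc_comp (@demand_continuous t) lsc).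
Qed.

End Minimizer.

(** * Minimizing the potential *)

Lemma sum_lty (R : realType) (I : finType) (f : I -> \bar R) i :
  (forall i, (-oo < f i)%E) -> (\sum_i f i < +oo)%E -> (f i < +oo)%E.
Proof.
move=> f0; rewrite (bigD1 i) //= !ltey; apply: contraNneq => ->.
rewrite addye // -ltNye big_mkcond; apply: sum_gtNy => j.
by case: ifP => // _; rewrite ltNyr.
Qed.

Section Potential.
Context {R : realType} {T n : nat} (d : mfg_data R T n).
Hypothesis hstanding : standing_assumption d.
Hypothesis hF : forall s, edifferentiable (F d s).
Hypothesis hphi : forall t, edifferentiable (phi d t : R^o -> \bar R).
Implicit Types (m u gamma : 'M[R]_(T.+1, n)) (pi : {ffun 'I_T -> 'M[R]_n}).
Implicit Types (P : 'rV[R]_T).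
Local Notation admissible pi := (forall t x, row x (pi t) \in edom (ell d t x)).

Lemma admissible_flow_ge0 pi m : admissible pi -> is_flow d pi m ->
  forall s x, 0 <= m s x.
Proof.
move=> dom; apply: is_flow_ge0; first by case: hstanding.
by move=> t x; exact: edom_simplex (dom t x).
Qed.

(** A solution of the system is found at a minimum of this criterion, whose
    derivatives in [m] and in the demand are the prices. *)
Definition potential m pi : R :=
  running_cost d m pi + \sum_(s < T.+1) fine (F d s (row s m)) +
  \sum_(t < T) fine (phi d t (demand d m pi t)).

Lemma epotentialE pi : admissible pi ->
  epotential d pi = (potential (flow d pi) pi)%:E.
Proof.
move=> dom; rewrite /potential !EFinD /epotential /running_cost.
rewrite -3!sumEFin; congr (_ + _ + _)%E.
- apply: eq_bigr => t _; rewrite -sumEFin; apply: eq_bigr => x _.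
  rewrite EFinM fineK; last exact: ell_fin_num.
  by rewrite ger0_norm //; apply: admissible_flow_ge0 dom (flowP d pi) _ _.
- by apply: eq_bigr => s _; rewrite fineK //; have [fin _] := hF s; exact: fin.
- by apply: eq_bigr => t _; rewrite fineK //; have [fin _] := hphi t; exact: fin.
Qed.

(** A minimizer over all stochastic kernels may have infinite [ell] where [m]
    vanishes. Replacing its rows there by points of the domain of [ell] changes
    neither the flow nor the cost, and makes the cost a real number. *)
Lemma potential_minimizer : exists pi, admissible pi /\
  forall pi', admissible pi' ->
    potential (flow d pi) pi <= potential (flow d pi') pi'.
Proof.
have [_ hell hF' hphi'] := hstanding.
have /choice[q0 dom0] (i : 'I_T * 'I_n) : exists r, edom (ell d i.1 i.2) r.
  by have [[_ [r dr]] _ _ _] := hell i.1 i.2; exists r.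
pose K := [set q : {ptws 'I_T * 'I_n -> 'rV[R]_n} | forall i, simplex n (q i)].
have sub i r : edom (ell d i.1 i.2) r -> simplex n r.
  by have [_ _ _] := hell i.1 i.2; exact.
have [||q Kq minq] := @lsc_attains_min _ _ K _ _ _ (lsc_epotential hstanding).
- apply: (@tychonoff _ (fun=> 'rV[R]_n) (fun=> simplex n)) => i.
  exact: simplex_compact.
- by exists q0 => i; exact: sub.
set pi := kernel_of q in minq; pose m := flow d pi.
pose pi1 := kernel_of (fun i => if m (now i.1) i.2 == 0 then q0 i else q i).
have eq_occ t x : m (now t) x != 0 -> row x (pi t) = row x (pi1 t).
  by move=> /negbTE m0; rewrite !row_kernel_of /= m0.
have [flow1 demand1] := eq_on_occupied_flow (flowP d pi) eq_occ.
have m1E : flow d pi1 = m by apply: is_flow_uniq (flowP d pi1) flow1.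
have JE : epotential d pi1 = epotential d pi.
  rewrite /epotential m1E; congr (_ + _ + _)%E; last first.
    by apply: eq_bigr => t _; rewrite -demand1.
  apply: eq_bigr => t _; apply: eq_bigr => x _.
  have [m0|/eq_occ ->//] := eqVneq (m (now t) x) 0.
  by rewrite -/m m0 normr0 !mul0e.
have kernel_surj pi' : kernel_of (fun i => row i.2 (pi' i.1)) = pi'.
  by apply/ffunP => t; apply/matrixP => x y; rewrite kernel_ofE mxE.
have min pi' : admissible pi' -> (epotential d pi <= epotential d pi')%E.
  move=> dom; rewrite -[pi']kernel_surj; apply: minq => i.
  by apply: sub; rewrite -inE.
have admissible0 : admissible (kernel_of q0).
  by move=> t x; rewrite row_kernel_of inE; exact: dom0 (t, x).
have Jlt : (epotential d pi < +oo)%E.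
  by apply: le_lt_trans (min _ admissible0) _; rewrite epotentialE // ltry.
(* Where [m] is positive, [ell] is finite since the total cost is. *)
have dom1 : admissible pi1.
  move=> t x; rewrite inE /pi1 row_kernel_of /=.
  case: eqVneq => [_|mN0]; first exact: dom0 (t, x).
  move: Jlt; rewrite /epotential.
  pose w t' x' := ((`|m (now t') x'|)%:E * ell d t' x' (row x' (pi t')))%E.
  have wN t' x' : (-oo < w t' x')%E by exact: weighted_ell_gtNy.
  have rowN t' : (-oo < \sum_(x' < n) w t' x')%E by exact: sum_gtNy.
  move=> Jlt; have : (\sum_(t' < T) \sum_(x' < n) w t' x' < +oo)%E.
    move: Jlt; rewrite !ltey; apply: contraNneq => ->.
    rewrite addye ?addye // -ltNye; apply: sum_gtNy => s.
      by have [[? _] _ _] := hphi' s.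
    by have [[? _] _ _] := hF' s.
  move=> /(sum_lty t rowN)/(sum_lty x (wN t)).
  rewrite /w row_kernel_of /edom /=; case: (ell d t x (q (t, x))) => [r _|/=|//].
    by rewrite ltry.
  by rewrite gt0_muley ?ltxx // lte_fin normr_gt0.
exists pi1; split=> // pi' dom'.
by rewrite -lee_fin -!epotentialE // JE; exact: min.
Qed.

(** Mixing distributions of states and state-action pairs, rather than kernels,
    makes the criterion convex; the kernel of the mixture is recovered by
    conditioning. *)
Lemma flow_mixture (l : R) pi m pi' m' : 0 < l < 1 ->
  admissible pi -> is_flow d pi m -> admissible pi' -> is_flow d pi' m' ->
  exists2 pil : {ffun 'I_T -> 'M[R]_n}, admissible pil &
    let ml : 'M[R]_(T.+1, n) := (1 - l) *: m + l *: m' in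
    [/\ is_flow d pil ml,
        running_cost d ml pil <=
          (1 - l) * running_cost d m pi + l * running_cost d m' pi' &
        forall t, demand d ml pil t =
          (1 - l) * demand d m pi t + l * demand d m' pi' t].
Proof.
move=> /andP[l0 l1] dom flow_m dom' flow_m'.
have m_ge0 := admissible_flow_ge0 dom flow_m.
have m'_ge0 := admissible_flow_ge0 dom' flow_m'.
pose ml : 'M[R]_(T.+1, n) := (1 - l) *: m + l *: m'.
(* Conditionally on state [x] at time [t], the mixture comes from [pi] with
   probability [a t x] and from [pi'] with probability [b t x]. *)
pose a t x := (1 - l) * m (now t) x / ml (now t) x.
pose b t x := l * m' (now t) x / ml (now t) x.
have mlE s x : ml s x = (1 - l) * m s x + l * m' s x by rewrite !mxE.
have lm_ge0 s x : 0 <= (1 - l) * m s x by apply: mulr_ge0 => //; lra.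
have lm'_ge0 s x : 0 <= l * m' s x by apply: mulr_ge0 => //; lra.
have ml_ge0 s x : 0 <= ml s x by rewrite mlE; exact: addr_ge0.
pose pil : {ffun 'I_T -> 'M[R]_n} := [ffun t => \matrix_(x, y)
  if ml (now t) x == 0 then pi t x y else a t x * pi t x y + b t x * pi' t x y].
have rowE t x : row x (pil t) = if ml (now t) x == 0 then row x (pi t)
    else a t x *: row x (pi t) + b t x *: row x (pi' t).
  by apply/rowP => y; rewrite !(mxE, ffunE); case: ifP; rewrite !mxE.
have split0 t x : ml (now t) x = 0 ->
    (1 - l) * m (now t) x = 0 /\ l * m' (now t) x = 0.
  move=> e; move: (lm_ge0 (now t) x) (lm'_ge0 (now t) x); rewrite mlE in e.
  by split; lra.
have massE t x y : ml (now t) x * pil t x y =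
    (1 - l) * (m (now t) x * pi t x y) + l * (m' (now t) x * pi' t x y).
  rewrite ffunE [X in _ * X]mxE !mulrA.
  case: eqVneq => [e|ne].
    by have [-> ->] := split0 _ _ e; rewrite e !mul0r addr0.
  by rewrite /a /b; field.
have cost t x : row x (pil t) \in edom (ell d t x) /\
    ml (now t) x * fine (ell d t x (row x (pil t))) <=
    (1 - l) * (m (now t) x * fine (ell d t x (row x (pi t)))) +
    l * (m' (now t) x * fine (ell d t x (row x (pi' t)))).
  rewrite rowE !mulrA; case: eqVneq => [e|ne].
    by have [-> ->] := split0 _ _ e; rewrite e !mul0r addr0; split.
  have [_ /(_ t x)[[gtNy _] cvx _ _] _ _] := hstanding.
  have [||//|] := econvex_fine (a := a t x) (b := b t x) gtNy cvx
    (dom t x) (dom' t x).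
  - exact: divr_ge0.
  - exact: divr_ge0.
  - by rewrite /a /b -mulrDl -mlE divff.
  move=> domab le; split=> //.
  apply: le_trans (ler_wpM2l (ml_ge0 _ _) le) _.
  by rewrite le_eqVlt; apply/orP; left; apply/eqP; rewrite /a /b; field.
exists pil; first by move=> t x; have [] := cost t x.
split=> //.
- have [mS m0E] := flow_m; have [mS' m0E'] := flow_m'.
  split=> [t x|x]; rewrite -/ml mlE; last by rewrite m0E m0E'; ring.
  by rewrite mS mS' !mulr_sumr -big_split; apply: eq_bigr => y _; rewrite massE.
- rewrite /running_cost !mulr_sumr -big_split; apply: ler_sum => t _ /=.
  rewrite !mulr_sumr -big_split; apply: ler_sum => x _ /=.
  by have [] := cost t x.
- move=> t; rewrite /demand !mulr_sumr -big_split; apply: eq_bigr => x _ /=.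
  rewrite !mulr_sumr -big_split; apply: eq_bigr => y _ /=.
  by rewrite massE; ring.
Qed.

End Potential.

(** * Existence *)

Section Existence.
Context {R : realType} {T n : nat} (d : mfg_data R T n).
Hypothesis hstanding : standing_assumption d.
Hypothesis hF : forall s, edifferentiable (F d s).
Hypothesis hphi : forall t, edifferentiable (phi d t : R^o -> \bar R).
Implicit Types (m u gamma : 'M[R]_(T.+1, n)) (pi : {ffun 'I_T -> 'M[R]_n}).
Implicit Types (P : 'rV[R]_T).
Local Notation admissible pi := (forall t x, row x (pi t) \in edom (ell d t x)).

(* The real-valued forms that [edifferentiable] differentiates. *)
Let realF s : 'rV[R]_n -> R^o := fun v => fine (F d s v).
Let realphi t : R^o -> R^o := fun v => fine (phi d t v).

(** Moving from the minimizer to the mixture with weight [l] on a competitor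
    cannot decrease the potential. The running cost increases by at most [l] times
    the difference of the two running costs, and the couplings are
    differentiable, so dividing by [l] and letting [l] tend to [0] gives the
    claim. *)
Lemma potential_min_linearized pi gamma P : admissible pi ->
  (forall pi', admissible pi' ->
    potential d (flow d pi) pi <= potential d (flow d pi') pi') ->
  (forall s h, dot (row s gamma) h = 'D_h (realF s) (row s (flow d pi))) ->
  (forall t (h : R^o), P 0 t * h = 'D_h (realphi t) (demand d (flow d pi) pi t)) ->
  forall pi', admissible pi' ->
    linearized_cost d gamma P (flow d pi) pi <=
    linearized_cost d gamma P (flow d pi') pi'.
Proof.
move=> dom min gradF gradphi pi' dom'.
set m := flow d pi; set m' := flow d pi'.
pose D := demand d m pi; pose D' := demand d m' pi'.
pose h s := row s m' - row s m; pose k t : R^o := D' t - D t.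
pose dF s l :=
  l^-1 * (fine (F d s (row s m + l *: h s)) - fine (F d s (row s m))).
pose dphi t l :=
  l^-1 * (fine (phi d t (D t + l *: k t)) - fine (phi d t (D t))).
have limit : \sum_s dF s l + \sum_t dphi t l @[l --> 0^'+] -->
    \sum_s dot (row s gamma) (h s) + \sum_t P 0 t * k t.
  apply: cvgD; apply: cvg_big => [|i _]; try exact: add_continuous.
    by rewrite gradF; exact: (cvg_quotient (hF i)).
  by rewrite gradphi; exact: (cvg_quotient (hphi i)).
have bound : running_cost d m pi - running_cost d m' pi' <=
    \sum_s dot (row s gamma) (h s) + \sum_t P 0 t * k t.
  apply: (cvgr_to_ge limit); near=> l.
  have l0 : 0 < l by near: l; exact: nbhs_right_gt.
  have l1 : l < 1 by near: l; exact: nbhs_right_lt.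
  have l01 : 0 < l < 1 by rewrite l0.
  have [pil doml [flowl costl demandl]] :=
    flow_mixture hstanding l01 dom (flowP d pi) dom' (flowP d pi').
  have := min _ doml; rewrite (is_flow_uniq (flowP d pil) flowl).
  rewrite -/m -/m' in flowl costl demandl *.
  set ml := (1 - l) *: m + l *: m' in flowl costl demandl *.
  have rowl s : row s ml = row s m + l *: h s.
    by apply/rowP => x; rewrite !mxE; ring.
  have dl t : demand d ml pil t = D t + l *: k t.
    by rewrite demandl /k /= -[l *: _]/(l * _) /D /D'; ring.
  have lF : l * (\sum_s dF s l) =
      \sum_s fine (F d s (row s ml)) - \sum_s fine (F d s (row s m)).
    rewrite mulr_sumr -sumrB; apply: eq_bigr => s _.
    by rewrite rowl mulVKf // gt_eqF.
  have lphi : l * (\sum_t dphi t l) =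
      \sum_t fine (phi d t (demand d ml pil t)) - \sum_t fine (phi d t (D t)).
    rewrite mulr_sumr -sumrB; apply: eq_bigr => t _.
    by rewrite dl mulVKf // gt_eqF.
  rewrite /potential => min_l; rewrite -(ler_pM2l l0) [leRHS]mulrDr lF lphi.
  by lra.
move: bound; rewrite /k /linearized_cost.
under eq_bigr do rewrite dotBr.
under [X in _ <= _ + X -> _]eq_bigr do rewrite mulrBr.
by rewrite !sumrB /D /D'; lra.
Unshelve. all: by end_near.
Qed.

Lemma bellman_attained u gamma P t x : exists2 rho, rho \in edom (ell d t x) &
  bellman_cost d u gamma P t x rho = bellman_value d u gamma P t x.
Proof.
have [_ /(_ t x)[[gtNy [r0 dr0]] _ lsc sub] _ _] := hstanding.
have lsc_cost : lower_semicontinuous (bellman_cost d u gamma P t x).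
  apply: lsc_add => //; first by move=> rho; rewrite ltNyr.
  apply: lsc_EFin => rho; apply: continuousD; first exact: cst_continuous.
  apply: continuous_sumR => y; apply: continuous_mulR.
    exact: coord_continuous.
  exact: cst_continuous.
have [|rho Srho minrho] := lsc_attains_min (@simplex_compact R n) _ lsc_cost.
  by exists r0; exact: sub.
exists rho; last first.
  apply/eqP; rewrite eq_le; apply/andP; split.
    by apply: le_ereal_inf_tmp => _ [r Sr <-]; exact: minrho.
  by apply: ereal_inf_lbound; exists rho.
have := minrho _ (sub _ dr0); move: dr0; rewrite inE /edom /bellman_cost /=.
case: (ell d t x r0) (gtNy r0) => // r _ _ .
by case: (ell d t x rho) (gtNy rho) => // s _ _; rewrite ltry.
Qed.

(** Dynamic programming: [u] is built backward from [gamma] at time [T]. *)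
Lemma bellman_solution gamma P : exists u pi,
  [/\ forall x, u ord_max x = gamma ord_max x,
      forall t x, (u (now t) x)%:E = bellman_value d u gamma P t x,
      admissible pi &
      forall t x, bellman_cost d u gamma P t x (row x (pi t)) =
        bellman_value d u gamma P t x].
Proof.
have [v [vT vS]] := backward_iterP (row ord_max gamma)
  (fun t (w : 'rV[R]_n) =>
     \row_x fine (bellman_value d (\matrix_(s, y) w 0 y) gamma P t x)).
pose u : 'M[R]_(T.+1, n) := \matrix_(s, x) v s 0 x.
have /choice[b bP] (i : 'I_T * 'I_n) : exists rho,
    rho \in edom (ell d i.1 i.2) /\
    bellman_cost d u gamma P i.1 i.2 rho = bellman_value d u gamma P i.1 i.2.
  by have [rho ? ?] := bellman_attained u gamma P i.1 i.2; exists rho.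
exists u, (kernel_of b); split=> [x|t x|t x|t x].
- by rewrite !mxE vT mxE.
- (* [u (now t)] was built from the row of [u] at [next t], the only one that
     [bellman_value] reads. *)
  have [dr costE] := bP (t, x); rewrite /= in dr costE; rewrite -costE.
  rewrite -[RHS]fineK; last first.
    by rewrite (bellman_costE _ _ _ (ell_fin_num hstanding dr)).
  rewrite mxE vS mxE; congr (fine _)%:E; rewrite (bP (t, x)).2.
  by apply: eq_bellman_value => y; rewrite !mxE.
- by rewrite row_kernel_of; have [] := bP (t, x).
- by rewrite row_kernel_of; have [] := bP (t, x).
Qed.

Lemma gradient_of s v : exists g, forall h, dot g h = 'D_h (realF s) v.
Proof.
have [_ /(_ v) df] := hF s.
have [g gE] := linear_dot ('d (realF s) v).
by exists g => h; rewrite gE deriveE.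
Qed.

(** Compare the minimizer [pi0] of the potential with the dynamic programming
    kernel [pis] in the linearized problem: [pis] has zero gaps, hence so has
    [pi0] wherever [m] is positive. Elsewhere the rows of [pis] are used. *)
Lemma MFG_exists : exists z, MFG d z.
Proof.
have [pi0 [dom0 min0]] := potential_minimizer hstanding hF hphi.
pose m := flow d pi0.
have /choice[g gE] s := gradient_of s (row s m).
pose gamma : 'M[R]_(T.+1, n) := \matrix_(s, x) g s 0 x.
have rowg s : row s gamma = g s by apply/rowP => x; rewrite !mxE.
pose P : 'rV[R]_T := \row_t ('D_(1 : R^o) (realphi t) (demand d m pi0 t) : R).
have dphi t (h : R^o) : P 0 t * h = 'D_h (realphi t) (demand d m pi0 t).
  have [_ /(_ (demand d m pi0 t)) df] := hphi t.
  rewrite mxE !deriveE // mulrC -[_ * _]/(h *: _) -linearZ /=.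
  by rewrite -[h *: _]/(_ * _) mulr1.
have dF s h : dot (row s gamma) h = 'D_h (realF s) (row s m) by rewrite rowg gE.
have [u [pis [uT uE doms opts]]] := bellman_solution gamma P.
have lin := potential_min_linearized dom0 min0 dF dphi doms.
have gap0 t x : m (now t) x != 0 -> gap d u gamma P t x (row x (pi0 t)) = 0.
  have m_ge0 := admissible_flow_ge0 hstanding dom0 (flowP d pi0).
  pose f t x := m (now t) x * gap d u gamma P t x (row x (pi0 t)).
  have f0 t' x' : 0 <= f t' x'.
    apply: mulr_ge0; first exact: m_ge0.
    exact: (bellman_gap_ge0 hstanding (uE t' x')).
  have sf0 t' : 0 <= \sum_x' f t' x' by exact: sumr_ge0.
  have sum0 : \sum_t' \sum_x' f t' x' = 0.
    apply/eqP; rewrite eq_le sumr_ge0 // andbT.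
    move: lin; rewrite (linearized_cost_gap P (flowP d pi0) uT).
    rewrite (linearized_cost_gap P (flowP d pis) uT) lerD2l => /le_trans; apply.
    rewrite big1 // => t' _; rewrite big1 // => x' _.
    by rewrite (bellman_gap_eq0 hstanding (uE t' x') (doms t' x')).1 ?mulr0.
  have st := psumr_eq0P (fun t' _ => sf0 t') sum0.
  have /(_ x isT)/eqP := psumr_eq0P (fun x' _ => f0 t x') (st t isT).
  by rewrite mulf_eq0 => /orP[/eqP->|/eqP//]; rewrite eqxx.
pose pi : {ffun 'I_T -> 'M[R]_n} := [ffun t => \matrix_(x, y)
  if m (now t) x == 0 then pis t x y else pi0 t x y].
have rowE t x : row x (pi t) =
    if m (now t) x == 0 then row x (pis t) else row x (pi0 t).
  by apply/rowP => y; rewrite !(mxE, ffunE); case: ifP; rewrite !mxE.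
have occ t x : m (now t) x != 0 -> row x (pi0 t) = row x (pi t).
  by move=> /negbTE mN0; rewrite rowE mN0.
have [flow_pi demand_pi] := eq_on_occupied_flow (flowP d pi0) occ.
exists (MFGVars m pi u gamma P); split.
- by [].
- move=> t x; rewrite rowE; case: eqVneq => [_|mN0].
    by split; [exact: (edom_simplex hstanding (doms t x))|].
  split; first exact: (edom_simplex hstanding (dom0 t x)).
  by apply/(bellman_gap_eq0 hstanding (uE t x) (dom0 t x)); exact: gap0.
- exact: flow_pi.
- have [_ _ hF' _] := hstanding.
  move=> s; rewrite inE; have [_ cvx _] := hF' s.
  exact: (subdifferential_gradient (hF s) cvx (dF s)).
- have [_ _ _ hphi'] := hstanding.
  move=> t; rewrite inE -demand_pi; have [_ cvx _] := hphi' t.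
  exact: (subdifferential_gradient (hphi t) cvx (dphi t)).
Qed.

End Existence.

Theorem proposition5p5 (R : realType) (T n : nat) (hT : (1 <= T)%N)
    (hn : (1 <= n)%N) (d : mfg_data R T n)
    (hstanding : standing_assumption d) (hqualif : qualification d)
    (hF : forall s, edifferentiable (F d s))
    (hphi : forall t, edifferentiable (phi d t : R^o -> \bar R)) :
  (forall z z' : mfg_vars R T n, MFG d z -> MFG d z' ->
     (vu z, vgamma z, vP z) = (vu z', vgamma z', vP z')) /\
  ((forall t x, strictly_convex_on_dom (ell d t x)) ->
   (forall z z' : mfg_vars R T n, MFG d z -> MFG d z' ->
      (vm z, vpi z) = (vm z', vpi z')) /\
   (exists! z : mfg_vars R T n, MFG d z)).
Proof.
have dual z z' : MFG d z -> MFG d z' ->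
    (vu z, vgamma z, vP z) = (vu z', vgamma z', vP z').
  case: z z' => [m pi u gamma P] [m' pi' u' gamma' P'] sol sol'.
  by have [/= -> -> ->] := MFG_dual_uniq hstanding hF hphi sol sol'.
split=> // sc.
have primal z z' : MFG d z -> MFG d z' -> (vm z, vpi z) = (vm z', vpi z').
  move=> sol sol'; have := dual z z' sol sol'; move: sol sol'.
  case: z z' => [m pi u gamma P] [m' pi' u' gamma' P'] /= sol sol' [uE gE PE].
  rewrite -uE -gE -PE in sol'.
  by have [-> ->] := MFG_primal_uniq hstanding sc sol sol'.
have [z sol] := MFG_exists hstanding hF hphi.
split=> //; exists z; split=> // z' sol'.
have := dual z z' sol sol'; have := primal z z' sol sol'.
by move=> {sol sol'}; case: z z' => [? ? ? ? ?] [? ? ? ? ?] /= [-> ->] [-> -> ->].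
Qed.
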